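(* Let $\{f(x;\theta):\theta\in\Theta\}$, $\Theta\subset\mathbb{R}$, be a family of probability densities on $\mathbb{R}$ such that $m(\theta)=\int_{-\infty}^{\infty}x f(x;\theta)\,dx$ is finite and continuous on $\Theta$, $f(x;\theta)$ is $TP_2$ in $(x,\theta)$, and for each $\theta$ the function $x\mapsto f(x;\theta)$ is logconcave. Then the moment estimator $\hat\theta=m^{-1}(\bar X)$ is increasing in $\theta$ with respect to the likelihood ratio order: if $\theta_1<\theta_2$ in $\Theta$ and $\hat\theta_1,\hat\theta_2$ are the moment estimators computed from i.i.d. samples of size $n$ from $f(\cdot;\theta_1)$ and $f(\cdot;\theta_2)$ respectively, then $\hat\theta_1\le_{\mathrm{lr}}\hat\theta_2$.
   Context: Moment estimator: for a sample $X_1,\dots,X_n$ i.i.d. with density $f(\cdot;\theta)$ and a function $g$ with $m(\theta)=\int g(x)f(x;\theta)\,dx$ monotone and continuous on $\Theta$, set $\bar g=\frac1n\sum_{i=1}^n g(X_i)$; it is assumed that $\bar g\in m(\Theta)$ for every possible sample, and the moment estimator is $\hat\theta=m^{-1}(\bar g)$, where $m^{-1}$ is the inverse of $m$ (a generalized monotone inverse if $m$ is only weakly monotone). Here $g(x)=x$, so $\bar g=\bar X$. A function $k(x,y)$ is $TP_2$ if $k\ge 0$ and $k(x_1,y_1)k(x_2,y_2)-k(x_1,y_2)k(x_2,y_1)\ge 0$ whenever $x_1<x_2$, $y_1<y_2$. For random variables $X,Y$ with densities $f_X,f_Y$, $X\le_{\mathrm{lr}}Y$ means $f_Y(x)/f_X(x)$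 is increasing in $x$. A function $h\ge0$ is logconcave if $\log h$ is concave (with $\log 0=-\infty$). *)

(* Defs.v *)
From HB Require Import structures.
From mathcomp Require Import all_boot all_order all_algebra.
From mathcomp Require Import all_classical all_reals all_analysis.
Set Implicit Arguments. Unset Strict Implicit. Unset Printing Implicit Defensive.
Import Order.TTheory GRing.Theory Num.Theory.
Import numFieldNormedType.Exports.
Local Open Scope classical_set_scope.
Local Open Scope ring_scope.

Section Defs.
Variable R : realType.

Definition moment (f : R -> R -> R) (th : R) : R :=
  fine (\int[@lebesgue_measure R]_x (x * f x th)%:E).

Definition TP2_on (X Y : set R) (k : R -> R -> R) : Prop :=
  (forall x y, X x -> Y y -> 0 <= k x y) /\
  (forall x1 x2 y1 y2, X x1 -> X x2 -> Y y1 -> Y y2 -> x1 < x2 -> y1 < y2 ->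
     0 <= k x1 y1 * k x2 y2 - k x1 y2 * k x2 y1).

Definition logE (h : R -> R) (x : R) : \bar R :=
  if h x == 0 then -oo%E else (ln (h x))%:E.

Definition logconcave (h : R -> R) : Prop :=
  (forall x, 0 <= h x) /\
  (forall x y t, 0 < t < 1 ->
     (t%:E * logE h x + (1 - t)%:E * logE h y <= logE h (t * x + (1 - t) * y))%E).

Definition monotone_on (S : set R) (g : R -> R) : Prop :=
  (forall x y, S x -> S y -> x <= y -> g x <= g y) \/
  (forall x y, S x -> S y -> x <= y -> g y <= g x).

Definition smean (s : seq R) : R := (\sum_(x <- s) x) / (size s)%:R.

Fixpoint iint (n : nat) (F : seq R -> \bar R) : \bar R :=
  match n with
  | 0 => F [::]
  | k.+1 => \int[@lebesgue_measure R]_x iint k (fun s => F (x :: s))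
  end.

(* law of the statistic g(Xbar) for an i.i.d. sample of size n from f(.;th):
   A |-> \int_{R^n} 1_A(g(mean x)) prod_i f(x_i;th) dx *)
Definition stat_law (f : R -> R -> R) (n : nat) (g : R -> R) (th : R)
  (A : set R) : \bar R :=
  iint n (fun s => ((\1_A (g (smean s)))%:E * (\prod_(x <- s) f x th)%:E)%E).

(* likelihood-ratio order between two laws on R: both have densities g1, g2
   w.r.t. a common measure mu, and g2/g1 is increasing (cross-multiplied form) *)
Definition lr_le (P1 P2 : set R -> \bar R) : Prop :=
  exists (mu : {measure set R -> \bar R}) (g1 g2 : R -> R),
    (forall x, 0 <= g1 x) /\ (forall x, 0 <= g2 x) /\
    measurable_fun setT g1 /\ measurable_fun setT g2 /\
    (forall A, measurable A -> (P1 A = \int[mu]_(x in A) (g1 x)%:E)%E) /\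
    (forall A, measurable A -> (P2 A = \int[mu]_(x in A) (g2 x)%:E)%E) /\
    (forall x y, x < y -> g2 x * g1 y <= g2 y * g1 x).

End Defs.

(* Main.v *)
Require Import Defs.
From HB Require Import structures.
From mathcomp Require Import all_boot all_order all_algebra.
From mathcomp Require Import all_classical all_reals all_analysis.
From mathcomp Require Import measurable_realfun.
From mathcomp Require Import ring lra.
Import Order.TTheory GRing.Theory Num.Theory.
Import numFieldNormedType.Exports.
Local Open Scope classical_set_scope.
Local Open Scope ring_scope.

(* By logconcavity each f(.;th) is bounded and is a Polya frequency function of
   order 2 (PF2), and TP2 says that f(.;th1) precedes f(.;th2) in the likelihood
   ratio order.  Andreief's identity shows that convolution with a PF2 density
   preserves this order and, applied to translates, the PF2 property, so the
   densities of the sums of n observations are ordered as well.  The same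
   identity shows that m is nondecreasing, so minv is strictly increasing on
   m(Theta); since every sample mean lies there, minv transports the order of
   the sums to the estimators.  Boundedness makes the convolutions finite at
   every point, which provides versions of the densities for which the
   likelihood ratio inequality holds everywhere and not only almost
   everywhere. *)

Set Implicit Arguments.
Unset Strict Implicit.
Unset Printing Implicit Defensive.

(** * Andreief's determinant inequality for integrals *)

Section Andreief.
Context {d : measure_display} {T : measurableType d} {R : realType}.
Variable mu : {measure set T -> \bar R}.

Lemma integrable_EFinZl (f : T -> R) (r : R) :
  mu.-integrable setT (EFin \o f) -> mu.-integrable setT (EFin \o (fun x => r * f x)).
Proof.
by move=> fi; apply: eq_integrable (integrableZl measurableT r fi).
Qed.

Lemma integrable_EFinD (f g : T -> R) :
  mu.-integrable setT (EFin \o f) -> mu.-integrable setT (EFin \o g) ->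
  mu.-integrable setT (EFin \o (fun x => f x + g x)).
Proof.
by move=> fi gi; apply: eq_integrable (integrableD measurableT fi gi).
Qed.

Lemma Rintegral_linear4 (F1 F2 F3 F4 : T -> R) (p q r s : R) :
  mu.-integrable setT (EFin \o F1) -> mu.-integrable setT (EFin \o F2) ->
  mu.-integrable setT (EFin \o F3) -> mu.-integrable setT (EFin \o F4) ->
  \int[mu]_x ((p * F1 x + q * F2 x) + (r * F3 x + s * F4 x)) =
  (p * \int[mu]_x F1 x + q * \int[mu]_x F2 x)
  + (r * \int[mu]_x F3 x + s * \int[mu]_x F4 x).
Proof.
move=> i1 i2 i3 i4.
do 3! rewrite ?RintegralD//; rewrite ?RintegralZl//;
  do ?[exact: integrable_EFinZl | apply: integrable_EFinD].
Qed.

(* Andreief's identity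
     2 (AC BE - AE BC) = \iint (a x b y - b x a y) (c x e y - c y e x) dx dy
   (AC := \int a c, etc.), read as iterated integrals so that no Fubini
   theorem is needed. *)
Lemma Rintegral_cross_le (a b c e : T -> R) :
  mu.-integrable setT (EFin \o (fun x => a x * c x)) ->
  mu.-integrable setT (EFin \o (fun x => a x * e x)) ->
  mu.-integrable setT (EFin \o (fun x => b x * c x)) ->
  mu.-integrable setT (EFin \o (fun x => b x * e x)) ->
  (forall x y, 0 <= (a x * b y - b x * a y) * (c x * e y - c y * e x)) ->
  (\int[mu]_x (a x * e x)) * (\int[mu]_x (b x * c x)) <=
  (\int[mu]_x (a x * c x)) * (\int[mu]_x (b x * e x)).
Proof.
move=> ac ae bc be pos.
set AC := \int[mu]_x (a x * c x); set AE := \int[mu]_x (a x * e x).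
set BC := \int[mu]_x (b x * c x); set BE := \int[mu]_x (b x * e x).
have inner y : 0 <= (AC * (b y * e y) + - AE * (b y * c y))
                    + (- BC * (a y * e y) + BE * (a y * c y)).
  have := @Rintegral_ge0 _ _ _ mu setT _ (fun x _ => pos x y).
  rewrite (@eq_Rintegral _ _ _ mu setT (fun x =>
     ((b y * e y) * (a x * c x) + (- (b y * c y)) * (a x * e x))
     + ((- (a y * e y)) * (b x * c x) + (a y * c y) * (b x * e x)))); last first.
    by move=> x _; ring.
  by rewrite Rintegral_linear4// -/AC -/AE -/BC -/BE; lra.
have := @Rintegral_ge0 _ _ _ mu setT _ (fun y _ => inner y).
by rewrite Rintegral_linear4// -/AC -/AE -/BC -/BE; lra.
Qed.

End Andreief.

(** * Invariance of Lebesgue measure under reflections and translations *)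

Section LebesgueReflection.
Context {R : realType}.
Local Notation mu := (@lebesgue_measure R).

Lemma measurable_reflect (c : R) : measurable_fun setT (fun x : R => c - x).
Proof. by apply: measurable_funB. Qed.

Lemma lebesgue_measure_reflect (c : R) (A : set R) : measurable A ->
  pushforward mu ((fun x => c - x) : _ -> measurableTypeR R) A = mu A.
Proof.
have mc := measurable_reflect c.
move=> mA; apply/esym.
apply: (@lebesgue_measure_unique R
  (pushforward mu ((fun x => c - x) : _ -> measurableTypeR R))) => //.
move=> _ [[a b]] _ <-.
rewrite /= /pushforward (_ : _ @^-1` _ = `[c - b, c - a[%classic); last first.
  by apply/seteqP; split => x /=; rewrite !in_itv/=; lra.
rewrite !lebesgue_measure_itv/= !lte_fin ltrD2l ltrN2.
by case: ifPn => // _; rewrite -!EFinB; congr EFin; ring.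
Qed.

Lemma ge0_integral_reflect (c : R) (F : R -> \bar R) :
  measurable_fun setT F -> (forall x, 0 <= F x)%E ->
  (\int[mu]_x F (c - x)%R = \int[mu]_x F x)%E.
Proof.
move=> mF F0; have mc := measurable_reflect c.
transitivity (\int[pushforward mu ((fun x => (c - x)%R) : _ -> measurableTypeR R)]_x F x)%E.
  by rewrite ge0_integral_pushforward.
by apply: eq_measure_integral => //= A mA _; exact: lebesgue_measure_reflect.
Qed.

(** A translation is the composition of two reflections. *)
Lemma ge0_integral_translate (c : R) (F : R -> \bar R) :
  measurable_fun setT F -> (forall x, 0 <= F x)%E ->
  (\int[mu]_x F (x + c)%R = \int[mu]_x F x)%E.
Proof.
move=> mF F0; rewrite -(ge0_integral_reflect c mF F0).
rewrite -(@ge0_integral_reflect 0 (fun x => F (c - x))%R)//.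
  by apply: eq_integral => x _; rewrite sub0r opprK addrC.
by apply: measurableT_comp => //; exact: measurable_reflect.
Qed.

End LebesgueReflection.

(** * Convolution, likelihood ratio order and PF2 densities *)

Section Convolution.
Context {R : realType}.
Local Notation mu := (@lebesgue_measure R).
Implicit Types (f g k : R -> R).

Definition lr_fun g1 g2 := forall u v, u < v -> g2 u * g1 v <= g2 v * g1 u.

(* Polya frequency of order 2: translating g to the right increases it in the
   likelihood ratio order. *)
Definition PF2 g := forall c, 0 < c -> lr_fun g (fun x => g (x - c)).

Definition bounded_density g :=
  [/\ forall x, 0 <= g x, measurable_fun setT g,
      (\int[mu]_x (g x)%:E = 1)%E & exists B, forall x, g x <= B].

Definition conv f g (s : R) : R := \int[mu]_y (f (s - y) * g y).

Lemma bounded_density_integrable g : bounded_density g ->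
  mu.-integrable setT (EFin \o g).
Proof.
move=> [g0 mg g1 _]; apply/integrableP; split; first exact/measurable_EFinP.
by under eq_integral do rewrite /= ger0_norm//; rewrite g1 ltry.
Qed.

Lemma bounded_density_translate g (c : R) : bounded_density g ->
  bounded_density (fun x => g (x - c)).
Proof.
move=> [g0 mg g1 [B gB]]; split => //.
- by apply: measurableT_comp => //; apply: measurable_funB.
- rewrite -g1 -[RHS](@ge0_integral_translate _ (- c) (EFin \o g))//.
  exact/measurable_EFinP.
- by exists B.
Qed.

Lemma bounded_density_neq0 g : bounded_density g -> ~ (forall x, g x = 0).
Proof.
move=> [_ _ g1 _] gE0; move: g1.
by under eq_integral do rewrite gE0; rewrite integral0 => /eqP; rewrite eqe eq_sym oner_eq0.
Qed.

(** A bound [B] of [f] dominates the integrand by [B * g] at every [s]; integrability of [f] alone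
    would give finiteness only for almost every [s]. *)
Lemma conv_integrable f g (s : R) : bounded_density f -> bounded_density g ->
  mu.-integrable setT (EFin \o (fun y => f (s - y) * g y)).
Proof.
move=> [f0 mf _ [B fB]] bg; have ig := bounded_density_integrable bg.
have [g0 mg _ _] := bg.
apply: (@le_integrable _ _ _ mu setT measurableT _
  (EFin \o (fun y => B * g y))) => //=.
- apply/measurable_EFinP; apply: measurable_funM => //.
  by apply: measurableT_comp => //; exact: measurable_reflect.
- move=> x _; rewrite lee_fin !ger0_norm ?mulr_ge0//.
    exact: ler_wpM2r.
  exact: le_trans (f0 0) (fB 0).
- exact: integrable_EFinZl.
Qed.

Lemma conv_EFin f g (s : R) : bounded_density f -> bounded_density g ->
  (\int[mu]_y (f (s - y) * g y)%:E = (conv f g s)%:E)%E.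
Proof.
by move=> bf bg; rewrite /conv fineK//; exact/integrable_fin_num/conv_integrable.
Qed.

Lemma conv_ge0 f g (s : R) : bounded_density f -> bounded_density g ->
  0 <= conv f g s.
Proof.
by move=> [f0 _ _ _] [g0 _ _ _]; apply: Rintegral_ge0 => y _; apply: mulr_ge0.
Qed.

Lemma convC f g : bounded_density f -> bounded_density g -> conv f g = conv g f.
Proof.
move=> [f0 mf _ _] [g0 mg _ _]; apply/funext => s; congr fine.
rewrite -(@ge0_integral_reflect _ s)//.
- by apply: eq_integral => y _; rewrite opprB addrC subrK mulrC.
- apply/measurable_EFinP; apply: measurable_funM => //.
  by apply: measurableT_comp => //; exact: measurable_reflect.
- by move=> x; rewrite lee_fin mulr_ge0.
Qed.

Lemma conv_gt0 f g (s : R) : bounded_density f -> bounded_density g ->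
  0 < conv f g s -> exists y, 0 < f (s - y) /\ 0 < g y.
Proof.
move=> [f0 _ _ _] [g0 _ _ _] cs; apply: contrapT => no.
move: cs; rewrite /conv (@eq_Rintegral _ _ _ mu setT (fun=> 0)).
  by rewrite Rintegral_cst// mul0r ltxx.
move=> y _; have [fy|fy] := ltP 0 (f (s - y)); have [gy|gy] := ltP 0 (g y).
- by exfalso; apply: no; exists y.
- by rewrite (_ : g y = 0) ?mulr0//; apply/le_anti; rewrite gy g0.
- by rewrite (_ : f _ = 0) ?mul0r//; apply/le_anti; rewrite fy f0.
- by rewrite (_ : f _ = 0) ?mul0r//; apply/le_anti; rewrite fy f0.
Qed.

Lemma measurable_conv_integrand f g : measurable_fun setT f ->
  measurable_fun setT g ->
  measurable_fun setT (fun z : R * R => (f (z.2 - z.1) * g z.1)%:E).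
Proof.
move=> mf mg; apply/measurable_EFinP; apply: measurable_funM.
  by apply: measurableT_comp => //; exact: measurable_funB.
exact: measurableT_comp.
Qed.

Lemma measurable_conv f g : bounded_density f -> bounded_density g ->
  measurable_fun setT (conv f g).
Proof.
move=> bf bg; have [f0 mf _ _] := bf; have [g0 mg _ _] := bg.
apply/measurable_EFinP.
have := @measurable_fun_fubini_tonelli_G _ _ _ _ _ mu _ (measurable_conv_integrand mf mg).
rewrite (_ : fubini_G _ _ = EFin \o conv f g).
  by apply => z; rewrite lee_fin mulr_ge0.
by apply/funext => s; rewrite /fubini_G/= conv_EFin.
Qed.

(** The convolution is the density of the sum of two independent variables: substitute [t = x + s]
    in the inner integral and exchange the integrals by Tonelli. *)
Lemma integral_conv f g (G : R -> \bar R) :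
  bounded_density f -> bounded_density g ->
  measurable_fun setT G -> (forall x, 0 <= G x)%E ->
  (\int[mu]_x \int[mu]_s (G (x + s)%R * (f s * g x)%:E) =
   \int[mu]_t (G t * (conv f g t)%:E))%E.
Proof.
move=> bf bg mG G0; have [f0 mf _ _] := bf; have [g0 mg _ _] := bg.
pose H (z : R * R) := (G z.2 * (f (z.2 - z.1) * g z.1)%:E)%E.
have mH : measurable_fun setT H.
  apply: emeasurable_funM; last exact: measurable_conv_integrand.
  exact: measurableT_comp.
have H0 z : (0 <= H z)%E by rewrite mule_ge0// lee_fin mulr_ge0.
transitivity (\int[mu]_x \int[mu]_t H (x, t))%E.
  apply: eq_integral => x _.
  rewrite -(@ge0_integral_translate _ x (fun t => H (x, t)))//.
    by apply: eq_integral => s _; rewrite /H/= addrK addrC.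
  exact: measurable_fun_pair2.
rewrite fubini_tonelli//; apply: eq_integral => t _.
rewrite /H/= ge0_integralZl ?conv_EFin//.
- apply/measurable_EFinP; apply: measurable_funM => //.
  by apply: measurableT_comp => //; exact: measurable_reflect.
- by move=> x _; rewrite lee_fin mulr_ge0.
Qed.

Lemma conv_bounded_density f g : bounded_density f -> bounded_density g ->
  bounded_density (conv f g).
Proof.
move=> bf bg; have [f0 mf f1 [B fB]] := bf; have [g0 mg g1 _] := bg; split.
- by move=> s; exact: conv_ge0.
- exact: measurable_conv.
- transitivity (\int[mu]_t (1 * (conv f g t)%:E))%E.
    by apply: eq_integral => t _; rewrite mul1e.
  rewrite -(@integral_conv f g (cst 1%E))// -[RHS]g1; apply: eq_integral => x _ /=.
  under eq_integral do rewrite mul1e mulrC EFinM.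
  rewrite ge0_integralZl ?f1 ?mule1 ?lee_fin//; first exact/measurable_EFinP.
  by move=> y _; rewrite lee_fin.
(* Averaging [f] against the unit mass of [g] keeps the bound of [f]. *)
- exists B; move=> s; rewrite -lee_fin -conv_EFin// -[leRHS]mule1 -g1.
  have B0 := le_trans (f0 0) (fB 0).
  rewrite -ge0_integralZl//.
  + apply: ge0_le_integral => //.
    * by move=> x _; rewrite lee_fin mulr_ge0.
    * apply/measurable_EFinP; apply: measurable_funM => //.
      by apply: measurableT_comp => //; exact: measurable_reflect.
    * by apply: emeasurable_funM => //; exact/measurable_EFinP.
    * by move=> x _; rewrite -EFinM lee_fin ler_wpM2r.
  + exact/measurable_EFinP.
  + by move=> x _; rewrite lee_fin.
Qed.

(** In Andreief's identity one determinant comes from [f] at [u] and [v], the other from [g2] and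
    [g1]. Both are nonpositive for [x < y] and nonnegative for [y < x], so their product is
    nonnegative. *)
Lemma conv_lr f g1 g2 : bounded_density f -> bounded_density g1 ->
  bounded_density g2 -> PF2 f -> lr_fun g1 g2 ->
  lr_fun (conv f g1) (conv f g2).
Proof.
move=> bf bg1 bg2 pf lrg u v uv.
rewrite [leLHS]mulrC.
apply: (@Rintegral_cross_le _ _ _ mu (fun y => f (v - y)) (fun y => f (u - y)) g2 g1);
  do ?exact: conv_integrable.
have key x y : x < y -> f (v - x) * f (u - y) - f (u - x) * f (v - y) <= 0 /\
    g2 x * g1 y - g2 y * g1 x <= 0.
  move=> xy; split; last by have := lrg _ _ xy; lra.
  have yx : 0 < y - x by rewrite subr_gt0.
  have := @pf _ yx (u - x) (v - x); rewrite ltrD2r => /(_ uv).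
  by rewrite (_ : u - x - (y - x) = u - y) 1?(_ : v - x - (y - x) = v - y); [lra|ring|ring].
move=> x y; have [/key[h1 h2]|/key[h1 h2]|->] := ltgtP x y.
- exact: mulr_le0.
- have h1' : 0 <= f (v - x) * f (u - y) - f (u - x) * f (v - y) by lra.
  have h2' : 0 <= g2 x * g1 y - g2 y * g1 x by lra.
  exact: mulr_ge0.
- by rewrite [_ * f (v - y)]mulrC subrr mul0r.
Qed.

(** Translating a convolution amounts to translating one factor, so [conv_lr] applies with kernel
    [g] to [f] and its translate. *)
Lemma conv_PF2 f g : bounded_density f -> bounded_density g -> PF2 f -> PF2 g ->
  PF2 (conv f g).
Proof.
move=> bf bg pf pg c c0.
have bfc := bounded_density_translate c bf.
rewrite (_ : (fun x => conv f g (x - c)) = conv (fun x => f (x - c)) g).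
  by rewrite convC// [conv (fun x => f _) g]convC//; apply: conv_lr => //; exact: pf.
by apply/funext => s; apply: eq_Rintegral => y _; rewrite addrAC.
Qed.

(* Cross-multiplied likelihood ratio comparisons compose only through a
   middle function that does not vanish identically. *)
Lemma lr_fun_trans g1 g2 g3 : (forall x, 0 <= g1 x) -> (forall x, 0 <= g2 x) ->
  (forall x, 0 <= g3 x) -> ~ (forall x, g2 x = 0) ->
  lr_fun g1 g2 -> lr_fun g2 g3 -> lr_fun g1 g3.
Proof.
move=> p1 p2 p3 n2 l12 l23 u v uv.
have [h1|h1] := ltP 0 (g1 v); last first.
  have -> : g1 v = 0 by apply/le_anti; rewrite h1 p1.
  by rewrite mulr0 mulr_ge0.
have [h3|h3] := ltP 0 (g3 u); last first.
  have -> : g3 u = 0 by apply/le_anti; rewrite h3 p3.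
  by rewrite mul0r mulr_ge0.
(* If [g2 u = 0], then [0 < g3 u] makes [g2] vanish to the right of [u], in particular at [v]; then
   [0 < g1 v] makes it vanish to the left of [v]. As [u < v], this covers the whole line. *)
have [h2u|h2u] := ltP 0 (g2 u); last first.
  have g2u : g2 u = 0 by apply/le_anti; rewrite h2u p2.
  have g2r w : u < w -> g2 w = 0.
    move=> uw; have := l23 _ _ uw; rewrite g2u mulr0 pmulr_rle0// => h.
    by apply/le_anti; rewrite h p2.
  exfalso; apply: n2 => w; have [wv|vw] := ltP w v; last first.
    by apply: g2r; exact: lt_le_trans vw.
  have := l12 _ _ wv; rewrite (g2r v uv) mul0r pmulr_lle0// => h.
  by apply/le_anti; rewrite h p2.
have a := l12 _ _ uv; have b := l23 _ _ uv.
have h2v : 0 < g2 v.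
  rewrite lt0r p2 andbT; have := lt_le_trans (mulr_gt0 h2u h1) a.
  by apply: contraTneq => ->; rewrite mul0r ltxx.
rewrite -(ler_pM2l (mulr_gt0 h2u h2v)).
have := ler_pM (mulr_ge0 (p2 u) (p1 v)) (mulr_ge0 (p3 u) (p2 v)) a b.
by congr (_ <= _); ring.
Qed.

(** The index is shifted: this is the density of a sum of [n.+1] observations. *)
Fixpoint conv_pow f n := if n is n'.+1 then conv (conv_pow f n') f else f.

Lemma conv_pow_bounded_density f n : bounded_density f ->
  bounded_density (conv_pow f n).
Proof. by move=> bf; elim: n => //= n IH; exact: conv_bounded_density. Qed.

Lemma conv_pow_PF2 f n : bounded_density f -> PF2 f -> PF2 (conv_pow f n).
Proof.
move=> bf pf; elim: n => //= n IH.
by apply: conv_PF2 => //; exact: conv_pow_bounded_density.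
Qed.

Lemma conv_pow_lr f1 f2 n : bounded_density f1 -> bounded_density f2 ->
  PF2 f1 -> PF2 f2 -> lr_fun f1 f2 ->
  lr_fun (conv_pow f1 n) (conv_pow f2 n).
Proof.
move=> b1 b2 p1 p2 l12; elim: n => //= n IH.
have c1 := conv_pow_bounded_density n b1.
have c2 := conv_pow_bounded_density n b2.
(* The factors are exchanged in two moves: first the single factor [f1], then the power of [f1] by
   the induction hypothesis. *)
apply: (@lr_fun_trans _ (conv (conv_pow f1 n) f2)).
- by move=> x; exact: conv_ge0.
- by move=> x; exact: conv_ge0.
- by move=> x; exact: conv_ge0.
- exact/bounded_density_neq0/conv_bounded_density.
- by apply: conv_lr => //; exact: conv_pow_PF2.
- by rewrite convC// [conv (conv_pow f2 n) f2]convC//; exact: conv_lr.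
Qed.

(** Exhibits [s] as the sum of a possible sample, to which the assumption on sample means can be
    applied. *)
Lemma conv_pow_gt0 f n (s : R) : bounded_density f -> 0 < conv_pow f n s ->
  exists l : seq R, [/\ size l = n.+1, \sum_(x <- l) x = s & all (fun x => 0 < f x) l].
Proof.
move=> bf; elim: n s => [|n IH] s /=.
  by move=> fs; exists [:: s]; rewrite big_seq1/= fs.
move=> /conv_gt0-/(_ (conv_pow_bounded_density n bf) bf)[y [/IH[l [sl suml fl]] fy]].
by exists (y :: l); rewrite /= sl big_cons suml fy addrC subrK.
Qed.

End Convolution.

(** * Logconcave densities are PF2 and bounded *)

Section Logconcave.
Context {R : realType}.
Local Notation mu := (@lebesgue_measure R).
Variable h : R -> R.
Hypothesis hlc : logconcave h.

Lemma logconcave_ln (a b t : R) : 0 < t < 1 -> 0 < h a -> 0 < h b ->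
  0 < h (t * a + (1 - t) * b) /\
  t * ln (h a) + (1 - t) * ln (h b) <= ln (h (t * a + (1 - t) * b)).
Proof.
move=> t01 ha hb; have [h0 /(_ a b t t01)] := hlc.
rewrite /logE (gt_eqF ha) (gt_eqF hb); case: ifPn => [_|hz].
  by rewrite -!EFinM -EFinD leeNy_eq.
by rewrite -!EFinM -EFinD lee_fin => ?; split => //; rewrite lt0r hz h0.
Qed.

Lemma logconcave_mul_le (a b t : R) : 0 < t < 1 ->
  h a * h b <= h (t * a + (1 - t) * b) * h ((1 - t) * a + t * b).
Proof.
move=> /andP[t0 t1]; have [h0 _] := hlc.
have [ha|ha] := ltP 0 (h a); last first.
  have -> : h a = 0 by apply/le_anti; rewrite ha h0.
  by rewrite mul0r mulr_ge0.
have [hb|hb] := ltP 0 (h b); last first.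
  have -> : h b = 0 by apply/le_anti; rewrite hb h0.
  by rewrite mulr0 mulr_ge0.
have [|p1 l1] := @logconcave_ln a b t _ ha hb; first by rewrite t0.
have [|] := @logconcave_ln a b (1 - t) _ ha hb; first lra.
rewrite (_ : 1 - (1 - t) = t); last by ring.
move=> p2 l2.
rewrite -ler_ln ?posrE ?mulr_gt0// !lnM ?posrE//; lra.
Qed.

Lemma logconcave_PF2 : PF2 h.
Proof.
move=> c c0 u v uv; have vu : 0 < v - u by rewrite subr_gt0.
have d0 : 0 < v - u + c by rewrite addr_gt0.
(* With this weight the two convex combinations of [u - c] and [v] are [u] and [v - c]. *)
have := @logconcave_mul_le (u - c) v ((v - u) / (v - u + c)).
have -> : 0 < (v - u) / (v - u + c) < 1.
  by rewrite divr_gt0//= ltr_pdivrMr// mul1r; lra.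
move=> /(_ isT); rewrite [leRHS]mulrC.
congr (_ <= h _ * h _); field; exact: lt0r_neq0.
Qed.

Hypothesis mh : measurable_fun setT h.
Hypothesis h1 : (\int[mu]_x (h x)%:E = 1)%E.

(* Integrate [2 sqrt (h a h b) <= h z + h (a + b - z)] over a < z < b. *)
Lemma logconcave_mul_sqr_le1 (a b : R) : a < b -> h a * h b * (b - a) ^+ 2 <= 1.
Proof.
move=> ab; have [h0 _] := hlc; have ba : 0 < b - a by rewrite subr_gt0.
set S := Num.sqrt (h a * h b).
have S0 : 0 <= S by exact: sqrtr_ge0.
have S2 : S ^+ 2 = h a * h b by rewrite sqr_sqrtr// mulr_ge0.
suff S1 : S * (b - a) <= 1.
  rewrite -S2 -exprMn -(expr1n _ 2) ler_pXn2r// nnegrE ?mulr_ge0//; exact: ltW.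
pose F (z : R) : \bar R := ((h z)%:E + (h (a + b - z))%:E)%E.
have F0 z : (0 <= F z)%E by rewrite adde_ge0 ?lee_fin.
have mh' : measurable_fun setT (fun z : R => (h (a + b - z))%:E).
  apply/measurable_EFinP; apply: measurableT_comp => //.
  exact: measurable_reflect.
have mF : measurable_fun setT F.
  by apply: emeasurable_funD => //; exact/measurable_EFinP.
have intF : (\int[mu]_z F z = 2%:E)%E.
  rewrite ge0_integralD//;
    do ?[exact/measurable_EFinP | by move=> x _; rewrite lee_fin].
  rewrite h1 (@ge0_integral_reflect _ (a + b) (EFin \o h))//.
    by rewrite [X in (_ + X)%E]h1.
  exact/measurable_EFinP.
have : ((2 * S)%:E * mu `]a, b[ <= \int[mu]_z F z)%E.
  rewrite -integral_cst//.
  apply: (@le_trans _ _ (\int[mu]_(z in `]a, b[) F z)%E); last first.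
    exact: ge0_subset_integral.
  apply: ge0_le_integral => //.
  - by move=> z _; rewrite lee_fin mulr_ge0.
  - exact: measurable_funTS.
  move=> z /=; rewrite in_itv/= => /andP[az zb].
  rewrite /F -EFinD lee_fin.
  have := @logconcave_mul_le a b ((b - z) / (b - a)).
  have -> : 0 < (b - z) / (b - a) < 1.
    by rewrite divr_gt0 ?subr_gt0//= ltr_pdivrMr// mul1r; lra.
  move=> /(_ isT).
  have -> : (b - z) / (b - a) * a + (1 - (b - z) / (b - a)) * b = z.
    by field; exact: lt0r_neq0.
  have -> : (1 - (b - z) / (b - a)) * a + (b - z) / (b - a) * b = a + b - z.
    by field; exact: lt0r_neq0.
  rewrite -S2 => key.
  (* AM-GM after squaring: the squared sum is at least four times the product, which is at least
     [S ^+ 2]. *)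
  rewrite -(@ler_pXn2r _ 2)// ?nnegrE ?mulr_ge0 ?addr_ge0//.
  have := sqr_ge0 (h z - h (a + b - z)); nra.
rewrite intF lebesgue_measure_itv/= lte_fin ab -EFinB -EFinM lee_fin; lra.
Qed.

(** Otherwise the unit mass would sit on at most one point, a null set. *)
Lemma logconcave_two_points : exists x y, [/\ x < y, 0 < h x & 0 < h y].
Proof.
have [h0 _] := hlc; apply: contrapT => no.
have [x hx] : exists x, 0 < h x.
  apply: contrapT => nox; move: h1.
  rewrite (eq_integral (cst 0%E)) ?integral0.
    by move=> /eqP; rewrite eqe eq_sym oner_eq0.
  move=> x _; congr EFin; apply/le_anti; rewrite h0 andbT leNgt.
  by apply/negP => hx; apply: nox; exists x.
suff E : (\int[mu]_y (h y)%:E = \int[mu]_(y in [set x]) (h y)%:E)%E.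
  by move: h1; rewrite E integral_set1 => /eqP; rewrite eqe eq_sym oner_eq0.
rewrite [RHS]integral_mkcond; apply: eq_integral.
move=> y _; rewrite patchE; case: ifPn => //; rewrite notin_setE/= => yx.
congr EFin; apply/le_anti; rewrite h0 andbT leNgt; apply/negP => hy; apply: no.
by have [xy|xy|xy] := ltgtP x y; [exists x, y|exists y, x|case: yx].
Qed.

(** Every [x] is at distance at least [(q - p) / 2] from one of two points [p < q] where [h] is
    positive, and [logconcave_mul_sqr_le1] bounds [h x] away from such a point. *)
Lemma logconcave_bounded_density : bounded_density h.
Proof.
have [h0 _] := hlc; split => //.
have [p [q [pq hp hq]]] := logconcave_two_points.
pose D := ((q - p) / 2) ^+ 2.
have D0 : 0 < D by rewrite exprn_gt0// divr_gt0// subr_gt0.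
have far r x : 0 < h r -> (q - p) / 2 <= `|x - r| -> h x <= 1 / (h r * D).
  move=> hr xr; rewrite ler_pdivlMr; last exact: mulr_gt0.
  have : h x * (h r * (x - r) ^+ 2) <= 1.
    have [xr'|xr'|xr'] := ltgtP x r.
    - by have := logconcave_mul_sqr_le1 xr'; lra.
    - by have := logconcave_mul_sqr_le1 xr'; lra.
    - by move: xr; rewrite xr' subrr normr0; lra.
  apply: le_trans; rewrite ler_wpM2l// (ler_wpM2l (ltW hr))// -[leRHS]real_normK ?num_real//.
  by rewrite ler_pXn2r// nnegrE; lra.
exists (1 / (h p * D) + 1 / (h q * D)); move=> x.
have bp : 0 <= 1 / (h p * D) by rewrite divr_ge0// mulr_ge0// ltW.
have bq : 0 <= 1 / (h q * D) by rewrite divr_ge0// mulr_ge0// ltW.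
have [xp|xp] := leP ((q - p) / 2) `|x - p|.
  by apply: (le_trans (far _ _ hp xp)); rewrite lerDl.
apply: (le_trans (far q x hq _)); last by rewrite lerDr.
have := ler_norm (x - p); have := ler_norm (q - x); rewrite distrC; lra.
Qed.

End Logconcave.

(** * Law of the sum of a sample *)

Section IteratedIntegral.
Context {R : realType}.
Local Notation mu := (@lebesgue_measure R).

Lemma eq_iint n (F F' : seq R -> \bar R) :
  (forall s, size s = n -> F s = F' s) -> iint n F = iint n F'.
Proof.
elim: n F F' => [|n IH] F F' FF' /=; first exact: FF'.
by apply: eq_integral => x _; apply: IH => s sn; apply: FF'; rewrite /= sn.
Qed.

Lemma iintS n (F : seq R -> \bar R) :
  (iint n.+1 F = \int[mu]_x iint n (fun s => F (x :: s)))%E.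
Proof. by []. Qed.

Lemma iint_conv_pow (f : R -> R) n (G : R -> \bar R) : bounded_density f ->
  measurable_fun setT G -> (forall x, 0 <= G x)%E ->
  (iint n.+1 (fun s => G (\sum_(x <- s) x)%R * (\prod_(x <- s) f x)%:E) =
   \int[mu]_t (G t * (conv_pow f n t)%:E))%E.
Proof.
move=> bf; have [f0 _ _ _] := bf.
elim: n G => [|n IH] G mG G0.
  by apply: eq_integral => x _ /=; rewrite !big_seq1.
have bn := conv_pow_bounded_density n bf.
rewrite iintS [RHS]/= -integral_conv//.
apply: eq_integral => x _.
(* The first observation [x] is absorbed into the test function, which is why the induction keeps
   [G] general. *)
transitivity (\int[mu]_t ((G (x + t)%R * (f x)%:E) * (conv_pow f n t)%:E))%E.
  rewrite -(@IH (fun t => G (x + t)%R * (f x)%:E)%E).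
  - apply: eq_iint => s _.
    by rewrite !big_cons EFinM muleA.
  - apply: emeasurable_funM => //.
    by apply: measurableT_comp => //; apply: measurable_funD.
  - by move=> t; rewrite mule_ge0 ?lee_fin.
by apply: eq_integral => t _; rewrite -muleA -EFinM [f x * _]mulrC.
Qed.

End IteratedIntegral.

(** * Transport of the likelihood ratio order by an increasing map *)

Section LikelihoodRatioPushforward.
Context {R : realType}.
Local Notation mu := (@lebesgue_measure R).

Lemma ge0_integral_mrestr {d : measure_display} {T : measurableType d}
    (m : {measure set T -> \bar R}) (J D : set T) (mJ : measurable J)
    (F : T -> \bar R) : measurable D ->
  measurable_fun D F -> (forall x, D x -> 0 <= F x)%E ->
  (\int[mrestr m mJ]_(x in D) F x = \int[m]_(x in D `&` J) F x)%E.
Proof.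
move=> mD mF F0.
rewrite (@ge0_negligible_integral _ _ _ (mrestr m mJ) D (~` J))//.
- rewrite setDE setCK; apply: eq_measure_integral => A mA AJ.
  by rewrite /= /mrestr setIidl// => x /AJ[].
- exact: measurableC.
- by rewrite /= /mrestr setICl measure0.
Qed.

(** The preimages of upper rays are intervals. *)
Lemma nondecreasing_emeasurable (e : R -> \bar R) :
  {homo e : s t / s <= t >-> (s <= t)%E} -> measurable_fun setT e.
Proof.
move=> e_nd; apply: (measurability (@ErealGenCInfty.G R)) => [|/= _ [_] [r] -> <-].
  exact: ErealGenCInfty.measurableE.
apply: measurableI => //; apply: is_interval_measurable => s t/=.
rewrite !in_itv/= !andbT => fs ft u /andP[su ut].
by rewrite in_itv/= andbT (le_trans fs)// e_nd.
Qed.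

(* Both laws are written with respect to the image by phi of the Lebesgue
   measure on J := {k1 + k2 > 0}; there phi is inverted by
   e t := sup {s in J | phi s <= t}, whose infinite values are given
   density 0. *)
Lemma lr_le_pushforward (k1 k2 phi : R -> R) (P1 P2 : set R -> \bar R) :
  (forall x, 0 <= k1 x) -> (forall x, 0 <= k2 x) ->
  measurable_fun setT k1 -> measurable_fun setT k2 -> lr_fun k1 k2 ->
  measurable_fun setT phi ->
  (forall u v, 0 < k1 u \/ 0 < k2 u -> 0 < k1 v \/ 0 < k2 v -> u < v ->
     phi u < phi v) ->
  (forall A, measurable A ->
     P1 A = \int[mu]_s ((\1_A (phi s))%:E * (k1 s)%:E))%E ->
  (forall A, measurable A ->
     P2 A = \int[mu]_s ((\1_A (phi s))%:E * (k2 s)%:E))%E ->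
  lr_le P1 P2.
Proof.
move=> k1_0 k2_0 mk1 mk2 lr mphi phi_inc P1E P2E.
pose J := [set s : R | 0 < k1 s + k2 s].
have JE s : J s -> 0 < k1 s \/ 0 < k2 s.
  rewrite /J/=; case: (ltP 0 (k1 s)) => [|h1]; first by left.
  by move=> h; right; lra.
have mJ : measurable J.
  rewrite (_ : J = (k1 \+ k2) @^-1` `]0, +oo[); last first.
    by apply/seteqP; split => s /=; rewrite in_itv/= andbT.
  by rewrite -[X in measurable X]setTI; exact: measurable_funD.
pose e t := ereal_sup (EFin @` [set s | J s /\ phi s <= t]).
have e_nd : {homo e : s t / s <= t >-> (s <= t)%E}.
  move=> s t st; apply: ereal_sup_le; apply: image_subset => x /= [Jx xs].
  by split => //; exact: le_trans st.
have me := nondecreasing_emeasurable e_nd.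
have eK s : J s -> e (phi s) = s%:E.
  move=> Js; apply/le_anti/andP; split.
    apply: ge_ereal_sup => _ [r [Jr rs] <-]; rewrite lee_fin leNgt.
    apply/negP => sr; have := phi_inc _ _ (JE _ Js) (JE _ Jr) sr.
    by rewrite ltNge rs.
  by apply: ereal_sup_ubound; exists s.
pose I := [set t | e t \is a fin_num].
have mI : measurable I.
  by have := emeasurable_fin_num measurableT me; rewrite setTI.
pose g (k : R -> R) t := \1_I t * k (fine (e t)).
have mg k : measurable_fun setT k -> measurable_fun setT (g k).
  move=> mk; apply: measurable_funM; first exact: measurable_indic.
  apply: measurableT_comp => //.
  by apply: measurableT_comp => //; exact: fine_measurable.
have g0 k t : (forall x, 0 <= k x) -> 0 <= g k t.
  by move=> k0; rewrite mulr_ge0// indicE ler0n.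
have gphi k s : J s -> g k (phi s) = k s.
  move=> Js; rewrite /g indicE mem_set ?mul1r; last by rewrite /I/= eK.
  by rewrite eK.
pose image_measure : {measure set R -> \bar R} := pushforward (mrestr mu mJ) phi.
pose nu := image_measure mphi.
have intg (k : R -> R) A : (forall x, 0 <= k x) -> measurable_fun setT k ->
    (forall s, ~ J s -> k s = 0) -> measurable A ->
    (\int[nu]_(x in A) (g k x)%:E =
     \int[mu]_s ((\1_A (phi s))%:E * (k s)%:E))%E.
  move=> k0 mk kJ mA.
  have mphiA : measurable (phi @^-1` A).
    by have := mphi measurableT _ mA; rewrite setTI.
  have mgE : measurable_fun setT (EFin \o g k) by apply/measurable_EFinP; exact: mg.
  rewrite [LHS]ge0_integral_pushforward//; first last.
  - by move=> x _; rewrite lee_fin g0.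
  - exact: measurable_funTS.
  rewrite ge0_integral_mrestr//; first last.
  - by move=> x _; rewrite /= lee_fin g0.
  - by apply: measurable_funTS; apply: measurableT_comp.
  rewrite integral_mkcond; apply: eq_integral => s _.
  rewrite patchE; case: ifPn => [/set_mem[/= As Js]|].
    by rewrite gphi// indicE mem_set// mul1e.
  rewrite notin_setE => /not_andP[nA|nJ].
    by rewrite indicE memNset// mul0e.
  by rewrite kJ// mule0.
have nJ1 s : ~ J s -> k1 s = 0.
  by move=> /negP; rewrite -leNgt => h; have := k1_0 s; have := k2_0 s; lra.
have nJ2 s : ~ J s -> k2 s = 0.
  by move=> /negP; rewrite -leNgt => h; have := k1_0 s; have := k2_0 s; lra.
exists nu, (g k1), (g k2); do 4?[split]; do ?[by move=> t; exact: g0 | exact: mg].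
split; [|split].
- by move=> A mA; rewrite P1E// intg.
- by move=> A mA; rewrite P2E// intg.
move=> x y xy; rewrite /g !indicE.
(* Off [I] both densities vanish, so both sides are 0; on [I] the inequality is that of [k1] and
   [k2] at the ordered points [e x] and [e y]. *)
have [/set_mem Ix|_] := boolP (x \in I); last by rewrite !mul0r mulr0.
have [/set_mem Iy|_] := boolP (y \in I); last by rewrite !mul0r mulr0.
rewrite !mul1r.
have : fine (e x) <= fine (e y) by rewrite fine_le// e_nd// ltW.
by rewrite le_eqVlt => /predU1P[->//|]; exact: lr.
Qed.

End LikelihoodRatioPushforward.

(** * Monotonicity of the mean *)

Section Moment.
Context {R : realType}.
Local Notation mu := (@lebesgue_measure R).

(** Andreief's identity with the functions [x] and [1] against [f2] and [f1]; the integrals of [1]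
    against the densities are 1. *)
Lemma lr_fun_mean_le (f1 f2 : R -> R) :
  bounded_density f1 -> bounded_density f2 -> lr_fun f1 f2 ->
  mu.-integrable setT (fun x => (x * f1 x)%:E) ->
  mu.-integrable setT (fun x => (x * f2 x)%:E) ->
  \int[mu]_x (x * f1 x) <= \int[mu]_x (x * f2 x).
Proof.
move=> b1 b2 lr i1 i2.
have one (f : R -> R) : bounded_density f -> \int[mu]_x (1 * f x) = 1.
  move=> [_ _ fE _]; rewrite /Rintegral.
  by under eq_integral do rewrite mul1r; rewrite fE.
have int1 (f : R -> R) : bounded_density f ->
    mu.-integrable setT (EFin \o (fun x => 1 * f x)).
  by move=> bf; exact/integrable_EFinZl/bounded_density_integrable.
have := @Rintegral_cross_le _ _ _ mu id (fun=> 1) f2 f1 i2 i1 (int1 _ b2) (int1 _ b1).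
rewrite !one// !mulr1; apply => x y; rewrite mulr1 mul1r.
have [xy|yx|->] := ltgtP x y.
- by apply: mulr_le0; have := lr _ _ xy; lra.
- by apply: mulr_ge0; have := lr _ _ yx; lra.
- by rewrite subrr mul0r.
Qed.

End Moment.

Unset Implicit Arguments.
Set Strict Implicit.

Theorem theorem1 (R : realType) (Theta : set R) (f : R -> R -> R)
  (n : nat) (minv : R -> R) (th1 th2 : R) :
  (* densities *)
  (forall th, Theta th ->
     (forall x, 0 <= f x th) /\ measurable_fun setT (fun x => f x th) /\
     (\int[@lebesgue_measure R]_x (f x th)%:E = 1)%E) ->
  (* m(theta) finite *)
  (forall th, Theta th ->
     (@lebesgue_measure R).-integrable setT (fun x => (x * f x th)%:E)) ->
  (* m continuous (and monotone: standing assumption) on Theta *)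
  {within Theta, continuous (moment f)} ->
  monotone_on Theta (moment f) ->
  (* TP2 in (x, theta) *)
  TP2_on setT Theta f ->
  (* logconcave in x *)
  (forall th, Theta th -> logconcave (fun x => f x th)) ->
  (* every possible sample mean lies in m(Theta) *)
  (forall th (s : seq R), Theta th -> size s = n ->
     all (fun x => 0 < f x th) s -> (moment f @` Theta) (smean s)) ->
  (* minv : a (generalized) monotone inverse of m on m(Theta), measurable *)
  (forall y, (moment f @` Theta) y -> Theta (minv y) /\ moment f (minv y) = y) ->
  monotone_on (moment f @` Theta) minv ->
  measurable_fun setT minv ->
  (0 < n)%N -> Theta th1 -> Theta th2 -> th1 < th2 ->
  lr_le (stat_law f n minv th1) (stat_law f n minv th2).
Proof.
move=> dens fin _ _ [_ tp2] lc supp minvP _ mminv n0 T1 T2 t12.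
have bd th : Theta th -> bounded_density (fun x => f x th).
  move=> Tth; have [_ [mf f1]] := dens _ Tth.
  exact: logconcave_bounded_density (lc _ Tth) mf f1.
have pf th : Theta th -> PF2 (fun x => f x th).
  by move=> Tth; exact: logconcave_PF2 (lc _ Tth).
have lr ta tb : Theta ta -> Theta tb -> ta < tb ->
    lr_fun (fun x => f x ta) (fun x => f x tb).
  by move=> Ta Tb ab u v uv; have := tp2 u v ta tb I I Ta Tb uv ab; lra.
have m_nd ta tb : Theta ta -> Theta tb -> ta <= tb -> moment f ta <= moment f tb.
  move=> Ta Tb; rewrite le_eqVlt => /predU1P[->//|ab].
  by apply: lr_fun_mean_le; [exact: bd|exact: bd|exact: lr|exact: fin|exact: fin].
(* From here the sample size is [n.+1], matching the index shift of [conv_pow]. *)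
case: n n0 supp => // n _ supp.
pose phi (s : R) := minv (s / n.+1%:R).
have mphi : measurable_fun setT phi.
  by apply: measurableT_comp => //; apply: measurable_funM.
have law th A : Theta th -> measurable A ->
    (stat_law f n.+1 minv th A = \int[@lebesgue_measure R]_s
      ((\1_A (phi s))%:E * (conv_pow (fun x => f x th) n s)%:E))%E.
  move=> Tth mA.
  rewrite -(@iint_conv_pow _ _ n (fun s => (\1_A (phi s))%:E) (bd _ Tth))//.
    by apply: eq_iint => s sn; rewrite /phi /smean sn.
  apply/measurable_EFinP.
  have mIA : measurable_fun setT (\1_A : R -> R) by exact: measurable_indic.
  exact: measurableT_comp mIA mphi.
have inM th s : Theta th -> 0 < conv_pow (fun x => f x th) n s ->
    (moment f @` Theta) (s / n.+1%:R).
  move=> Tth /(conv_pow_gt0 (bd _ Tth))[l [sl <- fl]].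
  by have := supp th l Tth sl fl; rewrite /smean sl.
have [c1_0 mc1 _ _] := conv_pow_bounded_density n (bd _ T1).
have [c2_0 mc2 _ _] := conv_pow_bounded_density n (bd _ T2).
apply: (lr_le_pushforward c1_0 c2_0 mc1 mc2 _ mphi).
- by apply: conv_pow_lr; [exact: bd|exact: bd|exact: pf|exact: pf|exact: lr].
(* Strictness needs only that [m] is nondecreasing: if [phi v <= phi u], applying [m], which [minv]
   inverts on the right, gives [v <= u]. *)
- move=> u v u0 v0 uv.
  have [Tu phiu] : Theta (phi u) /\ moment f (phi u) = u / n.+1%:R.
    by apply: minvP; case: u0; exact: inM.
  have [Tv phiv] : Theta (phi v) /\ moment f (phi v) = v / n.+1%:R.
    by apply: minvP; case: v0; exact: inM.
  rewrite ltNge; apply/negP => /(m_nd _ _ Tv Tu); rewrite phiu phiv leNgt.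
  by rewrite ltr_pM2r ?uv// invr_gt0 ltr0n.
- by move=> A mA; exact: law.
- by move=> A mA; exact: law.
Qed.
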